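(* Let $1<p<\infty$ and $0<q<p$. There is a constant $C=C(p,q)$ such that for every complex $M\times N$ matrix $A$, $$\frac1C\, h(A)\le h_{p,q}(A)\le C\, h(A).$$
   Context: Let $(\Omega,\Sigma,\mathbb P)$ be a probability space with a dyadic filtration $(\Sigma_k)_{k\ge0}$ (increasing sub-$\sigma$-algebras, each $\Sigma_k$ atomic with exactly $2^k$ atoms of probability $2^{-k}$). Let $\mathcal E_kf=\mathbb E(f\mid\Sigma_k)$ and $\Delta_kf=\mathcal E_kf-\mathcal E_{k-1}f$ for $k\ge1$. For a complex $M\times N$ matrix $A=(a_{jk})$: $h(A)$ is the least constant such that $\big\|\max_{1\le j\le M}|\sum_{k=1}^N a_{jk}\Delta_kf|\big\|_{L_2}\le h(A)\|f\|_{L_2}$ for all $f\in L_2(\Omega)$; and for $0<q<p<\infty$, $h_{p,q}(A)$ is the least constant such that $\big\|\max_{1\le j\le M}|\sum_{k=1}^N a_{jk}\Delta_kf|\big\|_{L_q}\le h_{p,q}(A)\|f\|_{L_p}$ for all $f\in L_p(\Omega)$. These constants do not depend on the choice of probability space and dyadic filtration. *)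

(* Defs.v *)
From HB Require Import structures.
From mathcomp Require Import all_boot all_order all_algebra.
From mathcomp Require Import all_classical all_reals all_analysis.
From mathcomp Require Import complex.
Set Implicit Arguments. Unset Strict Implicit. Unset Printing Implicit Defensive.
Import Order.TTheory GRing.Theory Num.Theory.
Local Open Scope classical_set_scope.
Local Open Scope ring_scope.
Local Open Scope complex_scope.

(* Model: Omega = [0,1) with Lebesgue measure, Sigma_k generated by the
   2^k dyadic intervals [n/2^k,(n+1)/2^k). *)
Section Dyadic.
Variable R : realType.

Definition Omega : set R := `[0%R, 1%R[%classic.

Lemma measurable_Omega : measurable Omega.
Proof. exact: measurable_itv. Qed.

Definition Prob := mrestr (@lebesgue_measure R) measurable_Omega.

Definition dyadic_atom (k : nat) (x : R) : set R :=
  let n : R := (Num.floor (x * 2 ^+ k))%:~R in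
  `[n / 2 ^+ k, (n + 1) / 2 ^+ k[%classic.

Definition cintegral (S : set R) (f : R -> R[i]) : R[i] :=
  (Rintegral (@lebesgue_measure R) S (fun x => complex.Re (f x)))
    +i* (Rintegral (@lebesgue_measure R) S (fun x => complex.Im (f x))).

(* E_k f = E(f | Sigma_k): average of f over the dyadic atom of level k *)
Definition condE (k : nat) (f : R -> R[i]) (x : R) : R[i] :=
  (2 ^+ k)%:C * cintegral (dyadic_atom k x) f.

(* Delta_k f = E_k f - E_{k-1} f  (used for k >= 1) *)
Definition mdiff (k : nat) (f : R -> R[i]) (x : R) : R[i] :=
  condE k f x - condE k.-1 f x.

(* max_{1<=j<=M} | sum_{k=1}^N a_{jk} Delta_k f | ;
   row j : 'I_M stands for j+1 and column k : 'I_N for k+1 *)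
Definition maxop (M N : nat) (A : 'M[R[i]]_(M, N)) (f : R -> R[i]) (x : R) : R :=
  \big[Num.max/0]_(j < M) ComplexField.Normc.normc (\sum_(k < N) A j k * mdiff k.+1 f x).

Definition Lpnorm (p : R) (g : R -> R) : \bar R :=
  Lnorm Prob p%:E (EFin \o g).

Definition inLp (p : R) (f : R -> R[i]) : Prop :=
  [/\ measurable_fun Omega (fun x => complex.Re (f x)),
      measurable_fun Omega (fun x => complex.Im (f x)) &
      (Lpnorm p (fun x => ComplexField.Normc.normc (f x)) < +oo)%E].

Definition admissible (p q : R) (M N : nat) (A : 'M[R[i]]_(M, N)) (C : R) : Prop :=
  0 <= C /\ forall f, inLp p f ->
    (Lpnorm q (maxop A f) <= C%:E * Lpnorm p (fun x => ComplexField.Normc.normc (f x)))%E.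

(* h_{p,q}(A): the least such constant (+oo if none) *)
Definition hpq (p q : R) (M N : nat) (A : 'M[R[i]]_(M, N)) : \bar R :=
  ereal_inf [set C%:E | C in admissible p q A].

Definition h (M N : nat) (A : 'M[R[i]]_(M, N)) : \bar R := hpq 2 2 A.

End Dyadic.

(* Main.v *)
(** Both inequalities follow from one extrapolation principle: if the maximal
    transform [T] of [A] is bounded from [L_p0] to [L_q0] with constant [H], for
    some [p0, q0 > 0], then it is bounded on [L_s] with constant [K(q0, s) * H]
    for every [s > 1].  On [L_s] only [E_N f] matters, so the question is about
    functions on binary words of length [N].

    Placing copies of a function on all dyadic intervals of a generation shows
    that the truncated transforms, starting at that generation, inherit the
    bound, and testing on a Rademacher function gives [|a_k| <= H].  Let [T*] be
    the maximal function of the partial sums.  If [|F_m| > l] at a stopping time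
    [m], then one of [F] and its reflection [2 F_m - F] exceeds [l] at the end;
    hence [T*] satisfies a weak type bound on bounded functions even for
    [q0 < 1], where Doob's inequality is not available.  Stopping [f] when the
    conditional expectation of [|f|] exceeds [eps * l] replaces [f] by a function
    bounded by [2 * eps * l], and this yields the good-lambda inequality
      P(T* f > 3 l, M f <= eps l / H) <= 2 (6 eps)^q0 P(T* f > l)
    with [M] the Doob maximal function.  Integrating against [l ^ (s - 1)] and
    using Doob's inequality gives the [L_s] bound. *)
Require Import Defs.
From HB Require Import structures.
From mathcomp Require Import all_boot all_order all_algebra.
From mathcomp Require Import all_classical all_reals all_analysis.
From mathcomp Require Import measurable_realfun complex.
From mathcomp Require Import ring lra.
Import Order.TTheory GRing.Theory Num.Theory.
Local Open Scope ring_scope.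

(** * Means over binary words *)

Section PathMean.

Fixpoint pathE (F : numFieldType) (n : nat) (g : seq bool -> F) : F :=
  if n is m.+1 then
    (pathE F m (g \o cons true) + pathE F m (g \o cons false)) / 2
  else g [::].
Arguments pathE {F}.

Lemma eq_pathE (F : numFieldType) n (f g : seq bool -> F) :
  f =1 g -> pathE n f = pathE n g.
Proof. by move=> fg; congr pathE; apply/funext. Qed.

Lemma pathE_cst (F : numFieldType) n (c : F) : pathE n (fun=> c) = c.
Proof. by elim: n => //= n IH; rewrite /comp IH; field. Qed.

Lemma pathED (F : numFieldType) n (f g : seq bool -> F) :
  pathE n (fun w => f w + g w) = pathE n f + pathE n g.
Proof. by elim: n f g => //= n IH f g; rewrite !IH; field. Qed.

Lemma pathEZ (F : numFieldType) n (c : F) (f : seq bool -> F) :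
  pathE n (fun w => c * f w) = c * pathE n f.
Proof. by elim: n f => //= n IH f; rewrite !IH; field. Qed.

Lemma pathE_behead (F : numFieldType) n (f : seq bool -> F) :
  pathE n.+1 (f \o behead) = pathE n f.
Proof. by rewrite /= (_ : f \o behead \o _ = f)//; field. Qed.

Lemma pathE_sum (F : numFieldType) n (J : nat) (f : nat -> seq bool -> F) :
  pathE n (fun w => \sum_(j < J) f j w) = \sum_(j < J) pathE n (f j).
Proof.
elim: J => [|J IH]; first by under eq_pathE do rewrite big_ord0;
  rewrite pathE_cst big_ord0.
by under eq_pathE do rewrite big_ord_recr; rewrite pathED IH big_ord_recr.
Qed.

End PathMean.
Arguments pathE {F}.

Section PathMeanOrder.
Variable R : realType.
Implicit Types f g : seq bool -> R.

Lemma le_pathE n f g : (forall w, f w <= g w) -> pathE n f <= pathE n g.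
Proof.
elim: n f g => [|n IH] f g fg //=.
by rewrite ler_pM2r ?invr_gt0// lerD// IH => // w; apply: fg.
Qed.

Lemma pathE_ge0 n f : (forall w, 0 <= f w) -> 0 <= pathE n f.
Proof. by move=> f0; rewrite -(pathE_cst R n 0); apply: le_pathE. Qed.

Lemma normc_ge0 (z : R[i]) : 0 <= ComplexField.Normc.normc z.
Proof. by case: z => a b; apply: sqrtr_ge0. Qed.

Lemma normc2 : ComplexField.Normc.normc (2 : R[i]) = 2.
Proof. by rewrite -[2 in LHS]/(1 *+ 2) normcMn ComplexField.Normc.normc1. Qed.

Lemma normc_pathE n (g : seq bool -> R[i]) :
  ComplexField.Normc.normc (pathE n g)
  <= pathE n (fun w => ComplexField.Normc.normc (g w)).
Proof.
elim: n g => [|n IH] g //=.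
rewrite ComplexField.Normc.normcM ComplexField.Normc.normcV normc2 ler_pM2r ?invr_gt0//.
by rewrite (le_trans (le_normcD _ _))// lerD//; apply: IH.
Qed.

Lemma powR_tangent (r x y : R) : 1 <= r -> 0 <= x -> 0 <= y ->
  r * y `^ (r - 1) * x <= x `^ r + (r - 1) * y `^ r.
Proof.
move=> r1 x0 y0; move: r1; rewrite le_eqVlt => /predU1P[<-|r1].
  by rewrite subrr powRr0 mul0r powRr1// !mul1r addr0.
have r0 : 0 < r by lra.
have r10 : 0 < r - 1 by lra.
have := @conjugate_powR _ x (y `^ (r - 1)) r (r / (r - 1)) x0 (powR_ge0 _ _) r0
  (divr_gt0 r0 r10).
have -> : r^-1 + (r / (r - 1))^-1 = 1 by field; rewrite !gt_eqF.
rewrite -powRrM mulrCA divff ?gt_eqF// mulr1 => /(_ erefl).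
rewrite -(ler_pM2l r0) => H.
rewrite (_ : _ * x = r * (x * y `^ (r - 1))); last by ring.
apply: (le_trans H); rewrite le_eqVlt; apply/predU1P; left.
by field; rewrite !gt_eqF.
Qed.

Lemma powR_pathE n r f : 1 <= r -> (forall w, 0 <= f w) ->
  pathE n f `^ r <= pathE n (fun w => f w `^ r).
Proof.
move=> r1 f0; set m := pathE n f.
have m0 : 0 <= m by apply: pathE_ge0.
have r0 : 0 < r by lra.
have : pathE n (fun w => r * m `^ (r - 1) * f w) <=
       pathE n (fun w => f w `^ r + (r - 1) * m `^ r).
  by apply: le_pathE => w; apply: powR_tangent.
rewrite pathEZ pathED pathE_cst -/m -mulrA [_ * m]mulrC mulr_powRB1//; lra.
Qed.

End PathMeanOrder.

(** * Martingale transforms and the good-lambda inequality *)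

Section Transform.
Variables (R : realType) (V : lmodType R[i]) (nv : V -> R).
Local Notation normc := (@ComplexField.Normc.normc R).
Hypothesis nvD : forall u v, nv (u + v) <= nv u + nv v.
Hypothesis nvZ : forall (c : R[i]) v, nv (c *: v) = normc c * nv v.
Implicit Types (a : nat -> V) (g : seq bool -> R[i]) (v : V) (w : seq bool).
Implicit Types (q H B k l : R).

Let nv0 : nv 0 = 0.
Proof. by rewrite -(scale0r 0) nvZ ComplexField.Normc.normc0 mul0r. Qed.

Let nvN v : nv (- v) = nv v.
Proof.
by rewrite -scaleN1r nvZ normcN ComplexField.Normc.normc1 mul1r.
Qed.

Let nv_ge0 v : 0 <= nv v.
Proof. by have := nvD v (- v); rewrite subrr nv0 nvN; lra. Qed.

Definition step n a v g b : V :=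
  v + (pathE n (g \o cons b) - pathE n.+1 g) *: a 0%N.

(* [transf n a v g w] is [v + \sum_(k < n) d_k *: a k], where [d_k] is the
   [k]-th martingale difference of [g] along the path [w]. *)
Fixpoint transf n a v g w : V :=
  if n is m.+1 then
    let b := head true w in
    transf m (a \o S) (step m a v g b) (g \o cons b) (behead w)
  else v.

Fixpoint transf_max n a v g w : R :=
  if n is m.+1 then
    let b := head true w in
    Num.max (nv v)
      (transf_max m (a \o S) (step m a v g b) (g \o cons b) (behead w))
  else nv v.

Fixpoint doob_max n (g : seq bool -> R) w : R :=
  if n is m.+1 then
    Num.max (pathE m.+1 g) (doob_max m (g \o cons (head true w)) (behead w))
  else g [::].

Lemma transfS n a v g w (b := head true w) : transf n.+1 a v g w =
  transf n (a \o S) (step n a v g b) (g \o cons b) (behead w).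
Proof. by []. Qed.

Lemma transf_maxS n a v g w (b := head true w) : transf_max n.+1 a v g w =
  Num.max (nv v)
    (transf_max n (a \o S) (step n a v g b) (g \o cons b) (behead w)).
Proof. by []. Qed.

Lemma doob_maxS n (g : seq bool -> R) w (b := head true w) : doob_max n.+1 g w =
  Num.max (pathE n.+1 g) (doob_max n (g \o cons b) (behead w)).
Proof. by []. Qed.

(* Only boundedness from [L_oo] to [L_q] is extracted from the hypothesis. *)
Definition transf_bounded (q H : R) n a : Prop :=
  forall g B, 0 <= B -> (forall w, normc (g w) <= B) ->
    pathE n (fun w => nv (transf n a 0 g w) `^ q) <= (H * B) `^ q.

Lemma stepD n a u v g b : step n a (u + v) g b = u + step n a v g b.
Proof. by rewrite /step addrA. Qed.

Lemma transfD n a u v g w : transf n a (u + v) g w = u + transf n a v g w.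
Proof. by elim: n a v g w => //= n IH a v g w; rewrite stepD IH. Qed.

Lemma le_nv_transf_max n a v g w : nv v <= transf_max n a v g w.
Proof. by case: n => //= n; rewrite le_max lexx. Qed.

Lemma transf_max_ge0 n a v g w : 0 <= transf_max n a v g w.
Proof. exact: le_trans (le_nv_transf_max _ _ _ _ _). Qed.

Lemma nv_transf_le_max n a v g w : nv (transf n a v g w) <= transf_max n a v g w.
Proof. by elim: n a v g w => //= n IH a v g w; rewrite le_max IH orbT. Qed.

Lemma transf_maxD n a u v g w :
  transf_max n a (u + v) g w <= nv u + transf_max n a v g w.
Proof.
elim: n a v g w => [|n IH] a v g w /=; first exact: nvD.
rewrite ge_max; apply/andP; split.
  by rewrite (le_trans (nvD _ _))// lerD2l le_max lexx.
by rewrite stepD (le_trans (IH _ _ _ _))// lerD2l le_max lexx orbT.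
Qed.

Lemma transf_max_bounded n a v g :
  exists B, forall w, transf_max n a v g w <= B.
Proof.
elim: n a v g => [|n IH] a v g; first by exists (nv v).
have [Bt Bt_ge] := IH (a \o S) (step n a v g true) (g \o cons true).
have [Bf Bf_ge] := IH (a \o S) (step n a v g false) (g \o cons false).
exists (Num.max (nv v) (Num.max Bt Bf)) => w /=.
rewrite ge_max !le_max lexx/=.
by case: (head true w); rewrite ?Bt_ge ?Bf_ge ?orbT.
Qed.

Lemma transf_cst n a v c w : transf n a v (fun=> c) w = v.
Proof.
elim: n a v w => //= n IH a v w.
rewrite IH /step (_ : pathE n _ = c); last exact: pathE_cst.
by rewrite (pathE_cst _ n.+1) subrr scale0r addr0.
Qed.

(* Two copies of [g] side by side have vanishing first difference. *)
Lemma transf_bounded_shift q H n a :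
  transf_bounded q H n.+1 a -> transf_bounded q H n (a \o S).
Proof.
move=> bnd g B B0 gB; have := bnd (g \o behead) B B0 (fun w => gB _).
rewrite (_ : (fun w => _) =
  (fun w => nv (transf n (a \o S) 0 g w) `^ q) \o behead) ?pathE_behead//.
apply/funext => w /=; congr (nv (transf _ _ _ _ _) `^ _).
by rewrite /step pathE_behead (_ : g \o behead \o _ = g)// subrr scale0r addr0.
Qed.

Lemma transf_bounded_coef q H n a : 0 < q -> 0 <= H ->
  transf_bounded q H n.+1 a -> nv (a 0%N) <= H.
Proof.
move=> q0 H0 bnd; pose g w : R[i] := if head true w then 1 else - 1.
have g1 w : normc (g w) <= 1.
  by rewrite /g; case: head; rewrite ?normcN ComplexField.Normc.normc1.
have := bnd g 1 ler01 g1.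
rewrite (_ : (fun _ => _) = (fun=> nv (a 0%N) `^ q)); last first.
  apply/funext => w /=; congr (_ `^ _).
  rewrite (_ : g \o _ = fun=> (if head true w then 1 else - 1)) //.
  rewrite transf_cst /step /= add0r.
  rewrite (_ : g \o cons true = fun=> 1) // (_ : g \o cons false = fun=> - 1) //.
  rewrite (_ : g \o _ = fun=> (if head true w then 1 else - 1)) //.
  rewrite !pathE_cst subrr mul0r subr0.
  by case: head; rewrite nvZ ?normcN ComplexField.Normc.normc1 mul1r.
rewrite pathE_cst mulr1; apply: contraTT; rewrite -!ltNge => lt_Ha.
by apply: gt0_ltr_powR => //; rewrite nnegrE.
Qed.

(* Reflects [g] about its current mean once the transform exceeds [l]. *)
Fixpoint reflect (l : R) n a v g w : R[i] :=
  if n is m.+1 then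
    if l < nv v then 2 * pathE m.+1 g - g w else
    let b := head true w in
    reflect l m (a \o S) (step m a v g b) (g \o cons b) (behead w)
  else g [::].

Lemma pathE_reflect l n a v g : pathE n (reflect l n a v g) = pathE n g.
Proof.
elim: n a v g => // n IH a v g; case: (boolP (l < nv v)) => lv.
  rewrite (_ : reflect _ _ _ _ _ = fun w => 2 * pathE n.+1 g + (- 1) * g w).
    by rewrite pathED pathE_cst pathEZ; ring.
  by apply/funext => w; rewrite mulN1r /= lv.
pose r b := reflect l n (a \o S) (step n a v g b) (g \o cons b).
transitivity ((pathE n (r true) + pathE n (r false)) / 2); last by rewrite !IH.
rewrite [LHS]/=.
by congr ((pathE _ _ + pathE _ _) / _); apply/funext => w /=; rewrite (negbTE lv).
Qed.

Lemma normc_reflect l n a v g B w : (forall w, normc (g w) <= B) ->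
  normc (reflect l n a v g w) <= 3 * B.
Proof.
have B3 x : 0 <= x -> x <= B -> x <= 3 * B by lra.
elim: n a v g w => [|n IH] a v g w gB; first by apply: B3 (normc_ge0 _ _) (gB _).
rewrite [reflect _ _ _ _ _ _]/=; case: ifPn => _; last by apply: IH => w'; apply: gB.
rewrite (le_trans (le_normcD _ _))// normcN ComplexField.Normc.normcM.
rewrite normc2.
have : normc (pathE n.+1 g) <= B.
  apply: le_trans (normc_pathE _ _ _) _; rewrite -[leRHS](pathE_cst R n.+1).
  exact: le_pathE.
by have := gB w; rewrite -/(pathE n.+1 g); lra.
Qed.

Lemma transf_sub n a v (c : R[i]) g w :
  transf n a v (fun w => c - g w) w = v + v - transf n a v g w.
Proof.
elim: n a v g w => [|n IH] a v g w /=; first by rewrite addrK.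
rewrite (_ : _ \o _ = (fun w' => c - (g \o cons (head true w)) w'))//.
have pE m (f : seq bool -> R[i]) : pathE m (fun w => c - f w) = c - pathE m f.
  under eq_pathE do rewrite -mulN1r.
  by rewrite pathED pathE_cst pathEZ mulN1r.
have -> : step n a v (fun w => c - g w) (head true w) =
    v + v - step n a v g (head true w).
  rewrite /step pE (_ : _ \o _ = (fun w' => c - (g \o cons (head true w)) w'))// pE.
  rewrite (_ : c - _ - _ = - (pathE n (g \o cons (head true w)) - pathE n.+1 g)); last by ring.
  by rewrite scaleNr opprD addrA addrK.
set s := step _ _ _ _ _.
rewrite (_ : v + v - s = (v + v - s - s) + s); last by rewrite addrNK.
rewrite transfD IH.
by rewrite [LHS]addrA; congr (_ - _); rewrite addrA !addrNK.
Qed.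

Lemma lt_transf_max_reflect l n a v g w : l < transf_max n a v g w ->
  (l < nv (transf n a v g w)) || (l < nv (transf n a v (reflect l n a v g) w)).
Proof.
elim: n a v g w => [|n IH] a v g w; first by move=> /= ->.
have [lv _|lv] := boolP (l < nv v).
  rewrite (_ : reflect _ _ _ _ _ = fun w => 2 * pathE n.+1 g - g w); last first.
    by apply/funext => w'; rewrite /= lv.
  rewrite transf_sub; set x := transf _ _ _ _ _; rewrite -[_ || _]negbK negb_or -!leNgt.
  apply/negP => /andP[x1 x2]; have := nvD x (v + v - x).
  have -> : x + (v + v - x) = (2 : R[i]) *: v by rewrite addrC addrNK scaler_nat mulr2n.
  rewrite nvZ normc2; lra.
rewrite transf_maxS lt_max (negbTE lv) orFb => /IH.
set b := head true w; set r := reflect l n _ _ _.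
suff -> : transf n.+1 a v (reflect l n.+1 a v g) w =
          transf n (a \o S) (step n a v g b) r (behead w) by [].
have rE : reflect l n.+1 a v g \o cons b = r.
  by apply/funext => w'; rewrite /= (negbTE lv).
by rewrite transfS -/b rE /step rE !pathE_reflect.
Qed.

Lemma weak_type_transf_max q H n a g B l : 0 < q -> 0 <= H -> 0 <= B -> 0 < l ->
  transf_bounded q H n a -> (forall w, normc (g w) <= B) ->
  pathE n (fun w => (l < transf_max n a 0 g w)%R%:R) <= 2 * (3 * H * B / l) `^ q.
Proof.
move=> q0 H0 B0 l0 bnd gB.
have lq0 : 0 < l `^ q by apply: powR_gt0.
have cheb (x : R) : 0 <= x -> (l < x)%R%:R <= x `^ q / l `^ q.
  move=> x0; case: ltP => lx; last by rewrite divr_ge0 ?powR_ge0.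
  rewrite ler_pdivlMr// mul1r ge0_ler_powR// ?nnegrE ?(ltW q0)//; exact: ltW.
pose g' := reflect l n a 0 g.
have -> : 2 * (3 * H * B / l) `^ q = ((H * (3 * B)) `^ q + (H * (3 * B)) `^ q) / l `^ q.
  rewrite powRM ?mulr_ge0 ?invr_ge0 ?(ltW l0)//.
  rewrite (_ : 3 * H * B = H * (3 * B)); last by ring.
  by rewrite -(powR_inv1 (ltW l0)) -powRrM mulN1r powRN; ring.
rewrite ler_pdivlMr// mulrC -pathEZ.
apply: (@le_trans _ _ (pathE n (fun w => nv (transf n a 0 g w) `^ q +
   nv (transf n a 0 g' w) `^ q))).
  apply: le_pathE => w; rewrite mulrC -ler_pdivlMr// mulrDl.
  have [/lt_transf_max_reflect|_] := ltP l (transf_max n a 0 g w).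
    case/orP => lx.
      apply: le_trans (_ : _ <= (l < nv (transf n a 0 g w))%R%:R) _; first by rewrite lx.
      by rewrite (le_trans (cheb _ _))// lerDl divr_ge0// powR_ge0.
    apply: le_trans (_ : _ <= (l < nv (transf n a 0 g' w))%R%:R) _; first by rewrite lx.
    by rewrite (le_trans (cheb _ _))// lerDr divr_ge0// powR_ge0.
  by rewrite addr_ge0// divr_ge0// powR_ge0.
rewrite pathED lerD//; apply: bnd; rewrite ?mulr_ge0// => w.
  by rewrite (le_trans (gB w))//; lra.
exact: normc_reflect.
Qed.

(* Stops [g] as soon as the conditional expectation of [`|g|] exceeds [k]. *)
Fixpoint prune (k : R) n g w : R[i] :=
  if n is m.+1 then
    if k < pathE m.+1 (normc \o g) then pathE m.+1 g
    else prune k m (g \o cons (head true w)) (behead w)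
  else g [::].

Lemma pathE_prune k n g : pathE n (prune k n g) = pathE n g.
Proof.
elim: n g => // n IH g; case: (boolP (k < pathE n.+1 (normc \o g))) => kg.
  rewrite (_ : prune _ _ _ = fun=> pathE n.+1 g) ?pathE_cst//.
  by apply/funext => w; rewrite /= in kg *; rewrite kg.
rewrite [LHS]/= [RHS]/=; rewrite /= in kg.
congr ((_ + _) / _); rewrite -[RHS]IH; congr pathE; apply/funext => w /=;
  by rewrite (negbTE kg).
Qed.

Lemma normc_prune k n g w : pathE n (normc \o g) <= 2 * k ->
  normc (prune k n g w) <= 2 * k.
Proof.
elim: n g w => // n IH g w gk; rewrite [prune _ _ _ _]/=.
case: ltP => kg; first exact: le_trans (normc_pathE _ _ _) gk.
apply: IH; move: kg => /=.
have := pathE_ge0 _ n (normc \o (g \o cons true)) (fun w => normc_ge0 _ _).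
have := pathE_ge0 _ n (normc \o (g \o cons false)) (fun w => normc_ge0 _ _).
by case: head; rewrite /comp /=; lra.
Qed.

Lemma le_pathE_doob_max n (g : seq bool -> R) w : pathE n g <= doob_max n g w.
Proof. by case: n => //= n; rewrite le_max lexx. Qed.

Lemma transf_max_prune k n a v g w : doob_max n (normc \o g) w <= k ->
  transf_max n a v (prune k n g) w = transf_max n a v g w.
Proof.
elim: n a v g w => // n IH a v g w.
rewrite doob_maxS ge_max => /andP[gk gk'].
have pg b : prune k n.+1 g \o cons b = prune k n (g \o cons b).
  by apply/funext => w' /=; rewrite ltNge gk.
rewrite [LHS]/= [RHS]/= !pg /step -/(pathE n.+1 (prune k n.+1 g)).
by rewrite pg !pathE_prune IH.
Qed.

Lemma weak_type_doob q H n a g k l : 0 < q -> 0 <= H -> 0 <= k -> 0 < l ->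
  transf_bounded q H n a ->
  pathE n (fun w => ((l < transf_max n a 0 g w) &&
                     (doob_max n (normc \o g) w <= k))%R%:R)
  <= 2 * (6 * H * k / l) `^ q.
Proof.
move=> q0 H0 k0 l0 bnd.
have [gk|gk] := leP (pathE n (normc \o g)) k; last first.
  rewrite (_ : (fun w => _) = fun=> 0) ?pathE_cst ?mulr_ge0 ?powR_ge0//.
  apply/funext => w; rewrite (leNgt _ k).
  by rewrite (lt_le_trans gk (le_pathE_doob_max _ _ _)) andbF.
have -> : 6 * H * k / l = 3 * H * (2 * k) / l by field; rewrite gt_eqF.
apply: (@le_trans _ _
    (pathE n (fun w => (l < transf_max n a 0 (prune k n g) w)%R%:R))).
  apply: le_pathE => w; case: (leP (doob_max _ _ _) k) => gk'.
    by rewrite andbT transf_max_prune.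
  by rewrite andbF ler0n.
apply: weak_type_transf_max => //; first by rewrite mulr_ge0.
by move=> w; apply: normc_prune; lra.
Qed.

(* At the first time the transform exceeds [l] it is at most [2 * l], because
   its last jump is at most [H * k]; the increment from then on is controlled
   by [weak_type_doob] for the shifted coefficients. *)
Lemma good_lambda q H n a v g k l : 0 < q -> 0 <= H -> 0 <= k -> 0 < l ->
  H * k <= l -> transf_bounded q H n a -> nv v <= l ->
  pathE n (fun w => ((3 * l < transf_max n a v g w) &&
                     (doob_max n (normc \o g) w <= k))%R%:R)
  <= 2 * (6 * H * k / l) `^ q * pathE n (fun w => (l < transf_max n a v g w)%R%:R).
Proof.
move=> q0 H0 k0 l0 Hk; set c := 2 * _.
have c0 : 0 <= c by rewrite mulr_ge0// powR_ge0.
elim: n a v g => [|n IH] a v g bnd vl.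
  have vl3 : (3 * l < nv v) = false by apply/negbTE; rewrite -leNgt; lra.
  by rewrite /= vl3 mulr_ge0// ler0n.
suff child b : pathE n (fun w => ((3 * l < transf_max n.+1 a v g (b :: w)) &&
                     (doob_max n.+1 (normc \o g) (b :: w) <= k))%R%:R)
  <= c * pathE n (fun w => (l < transf_max n.+1 a v g (b :: w))%R%:R).
  have := child true; have := child false.
  rewrite [X in _ -> _ -> X <= _]/= [X in _ -> _ -> _ <= _ * X]/= /comp; lra.
have bnd' := transf_bounded_shift _ _ _ _ bnd.
have vl3 : (3 * l < nv v) = false by apply/negbTE; rewrite -leNgt; lra.
have [gk|gk] := leP (pathE n.+1 (normc \o g)) k; last first.
  rewrite (_ : (fun w => _) = fun=> 0) ?pathE_cst.
    by rewrite mulr_ge0// pathE_ge0.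
  apply/funext => w; rewrite (leNgt _ k).
  by rewrite (lt_le_trans gk (le_pathE_doob_max _ _ _)) andbF.
set u := step n a v g b; set gb := g \o cons b.
rewrite (_ : (fun w => _) = (fun w => ((3 * l < transf_max n (a \o S) u gb w) &&
    (doob_max n (normc \o gb) w <= k))%R%:R)); last first.
  apply/funext => w; rewrite transf_maxS doob_maxS.
  by rewrite lt_max ge_max gk vl3.
rewrite (_ : (fun w => (l < _)%R%:R) = (fun w => (l < transf_max n (a \o S) u gb w)%R%:R));
  last first.
  by apply/funext => w; rewrite transf_maxS lt_max (ltNge _ (nv v)) vl.
have [ul|ul] := leP (nv u) l; first exact: IH.
rewrite (_ : (fun w => (l < _)%R%:R) = fun=> 1) ?pathE_cst ?mulr1; last first.
  by apply/funext => w; rewrite (lt_le_trans ul (le_nv_transf_max _ _ _ _ _)).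
apply: le_trans (weak_type_doob _ _ _ _ gb _ _ q0 H0 k0 l0 bnd').
have u2 : nv u <= 2 * l.
  rewrite (le_trans (nvD _ _))// nvZ.
  suff : normc (pathE n (g \o cons b) - pathE n.+1 g) * nv (a 0%N) <= l by lra.
  have aH := transf_bounded_coef _ _ _ _ q0 H0 bnd.
  suff dk : normc (pathE n (g \o cons b) - pathE n.+1 g) <= k.
    by apply: le_trans Hk; rewrite mulrC ler_pM// normc_ge0.
  apply: le_trans gk.
  have -> : pathE n (g \o cons b) - pathE n.+1 g =
     (pathE n (g \o cons b) - pathE n (g \o cons (~~ b))) / 2.
    by case: b @u @gb ul => /= _; field.
  rewrite ComplexField.Normc.normcM ComplexField.Normc.normcV normc2 ler_pM2r//.
  apply: le_trans (le_normcD _ _) _; rewrite normcN.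
  apply: le_trans (lerD (normc_pathE _ _ _) (normc_pathE _ _ _)) _.
  by case: b {u gb ul} => //; rewrite addrC.
apply: le_pathE => w; case: (doob_max _ _ w <= k); last by rewrite !andbF.
rewrite !andbT; case: (ltP (3 * l)) => u3; last exact: ler0n.
suff -> : l < transf_max n (a \o S) 0 gb w by [].
by have := transf_maxD n (a \o S) u 0 gb w; rewrite addr0; lra.
Qed.

End Transform.

(** * From good-lambda to moments *)

Section LayerCake.
Variable R : realType.
Implicit Types (s x mu : R) (J : nat).

Definition layers s mu J x : R :=
  \sum_(j < J) (3 ^+ j * mu < x)%R%:R * (3 ^+ j * mu) `^ s.

Lemma layersS s mu J x : layers s mu J.+1 x =
  layers s mu J x + (3 ^+ J * mu < x)%R%:R * (3 ^+ J * mu) `^ s.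
Proof. by rewrite /layers big_ord_recr. Qed.

Lemma powR3_gt1 s : 0 < s -> 1 < (3 : R) `^ s.
Proof.
move=> s0; suff : (1 : R) `^ s < 3 `^ s by rewrite powR1.
by apply: gt0_ltr_powR; rewrite ?nnegrE//; lra.
Qed.

Lemma level_powS s mu J : 0 < mu ->
  (3 ^+ J.+1 * mu) `^ s = 3 `^ s * (3 ^+ J * mu) `^ s.
Proof.
by move=> mu0; rewrite exprS -mulrA powRM ?mulr_ge0 ?exprn_ge0 ?(ltW mu0).
Qed.

Lemma layers_le s mu J x : 0 < s -> 0 < mu -> 0 <= x ->
  layers s mu J x <= 3 `^ s / (3 `^ s - 1) * x `^ s.
Proof.
move=> s0 mu0 x0; have b1 := powR3_gt1 _ s0; set b := 3 `^ s in b1 *.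
have b10 : 0 < b - 1 by lra.
have total J' : layers s mu J' x <= (3 ^+ J' * mu) `^ s / (b - 1).
  elim: J' => [|J' IH].
    by rewrite /layers big_ord0 divr_ge0 ?powR_ge0// ltW.
  rewrite layersS level_powS// -/b.
  have w0 : 0 <= (3 ^+ J' * mu) `^ s := powR_ge0 _ _.
  rewrite (_ : b * _ / _ = (3 ^+ J' * mu) `^ s / (b - 1) + (3 ^+ J' * mu) `^ s).
    by rewrite lerD//; case: (_ < x); rewrite ?mul1r ?mul0r.
  by field; rewrite gt_eqF.
elim: J => [|J IH].
  by rewrite /layers big_ord0 mulr_ge0 ?powR_ge0// divr_ge0 ?powR_ge0 ?ltW.
have [lx|lx] := ltP (3 ^+ J * mu) x; last first.
  by rewrite layersS ltNge lx mul0r addr0.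
apply: le_trans (total _) _; rewrite level_powS// -/b mulrAC.
rewrite ler_wpM2l ?divr_ge0 ?powR_ge0 ?(ltW b10)// ge0_ler_powR ?nnegrE ?(ltW s0)//.
  by rewrite mulr_ge0 ?exprn_ge0 ?(ltW mu0).
exact: ltW.
Qed.

Lemma powR_le_layers s mu J x : 0 < s -> 0 < mu -> 0 <= x -> x <= 3 ^+ J * mu ->
  x `^ s <= mu `^ s + 3 `^ s * layers s mu J x.
Proof.
move=> s0 mu0 x0; elim: J => [|J IH] xJ.
  rewrite /layers big_ord0 mulr0 addr0.
  by rewrite expr0 mul1r in xJ; rewrite ge0_ler_powR ?nnegrE ?(ltW s0) ?(ltW mu0).
rewrite layersS; have [lx|/IH lx] := ltP (3 ^+ J * mu) x; last first.
  by rewrite mul0r addr0.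
apply: (@le_trans _ _ ((3 ^+ J.+1 * mu) `^ s)).
  by rewrite ge0_ler_powR ?nnegrE ?mulr_ge0 ?exprn_ge0 ?(ltW s0) ?(ltW mu0).
rewrite level_powS// mul1r mulrDr addrA lerDr addr_ge0 ?powR_ge0//.
by rewrite mulr_ge0 ?powR_ge0// /layers sumr_ge0// => j _; rewrite mulr_ge0 ?ler0n ?powR_ge0.
Qed.

Lemma layers_le_shift s mu J x : 0 < mu ->
  layers s mu J x <= mu `^ s +
    3 `^ s * \sum_(j < J) (3 * (3 ^+ j * mu) < x)%R%:R * (3 ^+ j * mu) `^ s.
Proof.
move=> mu0; apply: (@le_trans _ _ (layers s mu J.+1 x)).
  by rewrite layersS lerDl mulr_ge0 ?ler0n ?powR_ge0.
rewrite /layers big_ord_recl expr0 mul1r lerD//.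
  by case: (_ < _); rewrite ?mul1r ?mul0r ?powR_ge0.
rewrite mulr_sumr ler_sum// => j _; rewrite lift0 level_powS// mulrCA exprS -mulrA.
exact: lexx.
Qed.

Lemma archi_pow3 mu x : 0 < mu -> exists J, x <= 3 ^+ J * mu.
Proof.
move=> mu0; exists (Num.trunc `|x / mu|).+1.
rewrite -ler_pdivrMr//; apply: le_trans (ler_norm _) _.
apply: le_trans (ltW (truncnS_gt _)) _.
rewrite -natrX ler_nat; exact/ltnW/ltn_expl.
Qed.

Lemma good_lambda_moment n s eps c (X Y : seq bool -> R) :
  0 < s -> 0 < eps -> 0 <= c -> c * 3 `^ s <= 2^-1 ->
  (forall w, 0 <= X w) -> (forall w, 0 <= Y w) ->
  (exists B, forall w, X w <= B) ->
  (forall l, 0 < l -> pathE n (fun w => ((3 * l < X w) && (Y w <= eps * l))%R%:R)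
     <= c * pathE n (fun w => (l < X w)%R%:R)) ->
  pathE n (fun w => X w `^ s) <=
    2 * (3 `^ s) ^+ 3 / (3 `^ s - 1) * eps^-1 `^ s * pathE n (fun w => Y w `^ s).
Proof.
move=> s0 eps0 c0 c3 X0 Y0 [B XB] goodl.
have b1 := powR3_gt1 _ s0; set b := 3 `^ s in c3 b1 *.
set K := 2 * _ / _ * _.
apply/ler_addgt0Pr => d d0.
pose mu := (d / (1 + 2 * b)) `^ s^-1.
have d'0 : 0 < d / (1 + 2 * b) by rewrite divr_gt0//; lra.
have mu0 : 0 < mu by apply: powR_gt0.
have mus : mu `^ s = d / (1 + 2 * b).
  by rewrite -powRrM mulVf ?gt_eqF// powRr1// ltW.
have [J BJ] := archi_pow3 mu B mu0.
pose L := pathE n (fun w => layers s mu J (X w)).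
pose L' := pathE n (fun w => layers s mu J (eps^-1 * Y w)).
have L'_le : L' <= b / (b - 1) * eps^-1 `^ s * pathE n (fun w => Y w `^ s).
  rewrite -pathEZ; apply: le_pathE => w; rewrite -[leRHS]mulrA -powRM ?invr_ge0 ?(ltW eps0)//.
  by apply: layers_le => //; rewrite mulr_ge0// invr_ge0 ltW.
have L_le : L <= mu `^ s + b * (c * L + L').
  apply: (@le_trans _ _ (pathE n (fun w => mu `^ s + b *
    (\sum_(j < J) (3 * (3 ^+ j * mu) < X w)%R%:R * (3 ^+ j * mu) `^ s)))).
    by apply: le_pathE => w; apply: layers_le_shift.
  rewrite pathED pathE_cst lerD2l pathEZ ler_wpM2l ?powR_ge0//.
  rewrite /L /L' /layers.
  rewrite (pathE_sum _ n J (fun j w => (3 * (3 ^+ j * mu) < X w)%R%:R * (3 ^+ j * mu) `^ s)).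
  rewrite (pathE_sum _ n J (fun j w => (3 ^+ j * mu < X w)%R%:R * (3 ^+ j * mu) `^ s)).
  rewrite (pathE_sum _ n J (fun j w => (3 ^+ j * mu < eps^-1 * Y w)%R%:R * (3 ^+ j * mu) `^ s)).
  rewrite mulr_sumr -big_split/= ler_sum// => j _.
  set l := 3 ^+ j * mu; have l0 : 0 < l by rewrite mulr_gt0 ?exprn_gt0.
  have cm (f : seq bool -> R) : pathE n (fun w => f w * l `^ s) = l `^ s * pathE n f.
    by rewrite -pathEZ; apply: eq_pathE => w; rewrite mulrC.
  rewrite !cm [c * _]mulrCA -mulrDr ler_wpM2l ?powR_ge0//.
  apply: le_trans (_ : _ <= pathE n (fun w =>
    ((3 * l < X w) && (Y w <= eps * l))%R%:R + (l < eps^-1 * Y w)%R%:R)) _.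
    apply: le_pathE => w; rewrite ltr_pdivlMl// (ltNge (eps * l)).
    case: (Y w <= eps * l); first by rewrite andbT lerDl ler0n.
    by rewrite andbF/= add0r lern1 leq_b1.
  by rewrite pathED lerD2r goodl.
have L0 : 0 <= L.
  apply: pathE_ge0 => w; apply: sumr_ge0 => j _.
  by rewrite mulr_ge0 ?ler0n ?powR_ge0.
have {}L_le : L <= 2 * mu `^ s + 2 * b * L'.
  have : (c * b) * L <= 2^-1 * L by rewrite ler_wpM2r.
  by move: L_le; rewrite mulrDr mulrA [b * c]mulrC; lra.
apply: (@le_trans _ _ (pathE n (fun w => mu `^ s + b * layers s mu J (X w)))).
  by apply: le_pathE => w; apply: powR_le_layers => //; apply: le_trans BJ.
rewrite pathED pathE_cst pathEZ -/L.
have b0 : 0 <= b by lra.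
apply: (@le_trans _ _ (mu `^ s + b * (2 * mu `^ s + 2 * b * L'))).
  by rewrite lerD2l ler_wpM2l.
have : 2 * b ^+ 2 * L' <= K * pathE n (fun w => Y w `^ s).
  apply: le_trans (_ : _ <= 2 * b ^+ 2 *
     (b / (b - 1) * eps^-1 `^ s * pathE n (fun w => Y w `^ s))) _.
    by rewrite ler_wpM2l// mulr_ge0// exprn_ge0.
  rewrite le_eqVlt; apply/predU1P; left; rewrite /K.
  by field; rewrite gt_eqF//; lra.
have : mu `^ s + b * (2 * mu `^ s) = d.
  by rewrite mus; field; rewrite gt_eqF//; lra.
rewrite expr2; lra.
Qed.

End LayerCake.

(** * Doob's inequality and the strong type estimate *)

Section Doob.
Variable R : realType.
Implicit Types (s m x y : R) (g : seq bool -> R).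

(* Burkholder's function for Doob's inequality: linear in [x], with
   [burk s x x <= burk s y x] whenever [y <= x]. *)
Definition burk s y x : R := y `^ s - s / (s - 1) * y `^ (s - 1) * x.

Lemma burk_diag s x y : 1 < s -> 0 <= x -> 0 <= y -> burk s x x <= burk s y x.
Proof.
move=> s1 x0 y0; have s10 : 0 < s - 1 by lra.
have tgt := powR_tangent _ _ _ _ (ltW s1) x0 y0.
rewrite /burk -(ler_pM2l s10).
have xs : x `^ s = x `^ (s - 1) * x by rewrite mulrC mulr_powRB1//; lra.
have -> : (s - 1) * (x `^ s - s / (s - 1) * x `^ (s - 1) * x) = - x `^ s.
  by rewrite xs; field; rewrite gt_eqF.
have -> : (s - 1) * (y `^ s - s / (s - 1) * y `^ (s - 1) * x) =
   (s - 1) * y `^ s - s * y `^ (s - 1) * x by field; rewrite gt_eqF.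
lra.
Qed.

Lemma pathE_burk s n m g : 1 < s -> 0 <= m -> (forall w, 0 <= g w) ->
  pathE n g <= m ->
  pathE n (fun w => burk s (Num.max m (doob_max R n g w)) (g w))
  <= burk s m (pathE n g).
Proof.
move=> s1; elim: n m g => [|n IH] m g m0 g0 gm.
  by rewrite /= max_l.
have e0 b : 0 <= pathE n (g \o cons b) by apply: pathE_ge0 => w; apply: g0.
suff child b : pathE n (fun w => burk s (Num.max m (doob_max R n.+1 g (b :: w)))
    ((g \o cons b) w)) <= burk s m (pathE n (g \o cons b)).
  have -> : burk s m (pathE n.+1 g) =
      (burk s m (pathE n (g \o cons true)) + burk s m (pathE n (g \o cons false))) / 2.
    by rewrite /burk /=; field; rewrite gt_eqF//; lra.
  rewrite -[leLHS]/((_ + _) / 2) ler_pM2r ?invr_gt0//.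
  by apply: lerD; [exact: child true|exact: child false].
have -> : (fun w => burk s (Num.max m (doob_max R n.+1 g (b :: w))) ((g \o cons b) w)) =
    (fun w => burk s (Num.max m (doob_max R n (g \o cons b) w)) ((g \o cons b) w)).
  by apply/funext => w; rewrite doob_maxS maxA (max_l gm).
have [gbm|/ltW gbm] := leP (pathE n (g \o cons b)) m.
  by apply: IH => // w; apply: g0.
have -> : (fun w => burk s (Num.max m (doob_max R n (g \o cons b) w)) ((g \o cons b) w)) =
  (fun w => burk s (Num.max (pathE n (g \o cons b)) (doob_max R n (g \o cons b) w))
     ((g \o cons b) w)).
  apply/funext => w; have ge := le_pathE_doob_max R n (g \o cons b) w.
  by rewrite (max_r ge) max_r// (le_trans gbm).
apply: le_trans (IH _ _ _ _ _) _ => //; first by move=> w; apply: g0.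
exact: burk_diag.
Qed.

Lemma doob_max_ge0 n g w : (forall w, 0 <= g w) -> 0 <= doob_max R n g w.
Proof. by move=> g0; apply: le_trans (le_pathE_doob_max _ _ _ _); apply: pathE_ge0. Qed.

Lemma doob_inequality s n g : 1 < s -> (forall w, 0 <= g w) ->
  pathE n (fun w => doob_max R n g w `^ s) <=
  2 * (s / (s - 1) * (2 * (s / (s - 1))) `^ (s - 1)) * pathE n (fun w => g w `^ s).
Proof.
move=> s1 g0; set s' := s / (s - 1); set K := s' * _.
have s'0 : 0 < s' by rewrite divr_gt0; lra.
have K0 : 0 <= K by rewrite mulr_ge0 ?powR_ge0// ltW.
set M := doob_max R n g.
have M0 w : 0 <= M w by apply: doob_max_ge0.
have e0 : 0 <= pathE n g by apply: pathE_ge0.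
have : pathE n (fun w => burk s (M w) (g w)) <= 0.
  have := pathE_burk s n (pathE n g) g s1 e0 g0 (lexx _).
  rewrite (_ : (fun w => _) = fun w => burk s (M w) (g w)); last first.
    by apply/funext => w; rewrite max_r// le_pathE_doob_max.
  move=> /le_trans; apply; apply: le_trans (burk_diag _ _ 0 _ _ _) _ => //.
  by rewrite /burk !powR0 ?gt_eqF ?subr_gt0//; lra.
have : pathE n (fun w => M w `^ s) <= pathE n (fun w => burk s (M w) (g w) +
    (2^-1 * M w `^ s + K * g w `^ s)).
  apply: le_pathE => w; rewrite /burk -/s'.
  suff : s' * M w `^ (s - 1) * g w <= 2^-1 * M w `^ s + K * g w `^ s by lra.
  have [gM|/ltW gM] := leP (2 * s' * g w) (M w).
    rewrite -[leLHS]addr0 lerD// ?(mulr_ge0 K0 (powR_ge0 _ _))//.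
    rewrite -[M w `^ s](mulr_powRB1 (M0 w)); last by lra.
    rewrite mulrAC [leRHS]mulrA ler_wpM2r ?powR_ge0//; lra.
  rewrite -[leLHS]add0r lerD ?mulr_ge0 ?powR_ge0//.
  rewrite -[g w `^ s](mulr_powRB1 (g0 w)); last by lra.
  rewrite /K -[leLHS]mulrA -[leRHS]mulrA ler_wpM2l ?(ltW s'0)// [leRHS]mulrCA.
  have s2 : 0 <= 2 * s' by lra.
  have sg0 : 0 <= 2 * s' * g w by rewrite (mulr_ge0 s2 (g0 w)).
  rewrite mulrC ler_wpM2l// -powRM//.
  by apply: ge0_ler_powR; rewrite ?nnegrE//; lra.
rewrite !pathED !pathEZ; lra.
Qed.

End Doob.

Theorem transf_strong (R : realType) (q s : R) : 0 < q -> 1 < s ->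
  exists K : R, 0 < K /\
  forall (V : lmodType R[i]) (nv : V -> R)
    (nvD : forall u v, nv (u + v) <= nv u + nv v)
    (nvZ : forall (c : R[i]) v, nv (c *: v) = ComplexField.Normc.normc c * nv v)
    (n : nat) (a : nat -> V) (H : R), 0 < H -> transf_bounded R V nv q H n a ->
  forall g : seq bool -> R[i],
    pathE n (fun w => nv (transf R V n a 0 g w) `^ s) <=
    K * H `^ s * pathE n (fun w => ComplexField.Normc.normc (g w) `^ s).
Proof.
move=> q0 s1; have s0 : 0 < s by lra.
have b1 := powR3_gt1 R _ s0.
set b := 3 `^ s in b1; have b0 : 0 < b by lra.
pose eta : R := Num.min 1 ((4 * b)^-1 `^ q^-1 / 6).
have eta0 : 0 < eta.
  by rewrite lt_min ltr01 divr_gt0// powR_gt0// invr_gt0 mulr_gt0.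
have eta1 : eta <= 1 by rewrite ge_min lexx.
have etab : 2 * (6 * eta) `^ q * b <= 2^-1.
  suff : (6 * eta) `^ q <= (4 * b)^-1.
    rewrite -(ler_pM2r b0) (_ : (4 * b)^-1 * b = 4^-1); first by lra.
    by field; rewrite gt_eqF.
  apply: le_trans (_ : _ <= ((4 * b)^-1 `^ q^-1) `^ q) _.
    rewrite ge0_ler_powR ?nnegrE ?mulr_ge0 ?powR_ge0 ?(ltW q0) ?(ltW eta0)//.
    by rewrite mulrC -ler_pdivlMr// ge_min lexx orbT.
  by rewrite -powRrM mulVf ?gt_eqF// powRr1// invr_ge0 mulr_ge0// ltW.
pose Kd := 2 * (s / (s - 1) * (2 * (s / (s - 1))) `^ (s - 1)).
have Kd0 : 0 < Kd.
  by rewrite !mulr_gt0 ?powR_gt0 ?mulr_gt0 ?invr_gt0//; lra.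
pose K1 := 2 * b ^+ 3 / (b - 1).
have K10 : 0 < K1 by rewrite divr_gt0 ?mulr_gt0 ?exprn_gt0//; lra.
exists (K1 * eta^-1 `^ s * Kd); split.
  by apply: mulr_gt0 => //; apply: mulr_gt0 => //; rewrite powR_gt0// invr_gt0.
move=> V nv nvD nvZ n a H H0 bnd g.
pose ag w := ComplexField.Normc.normc (g w).
have ag0 w : 0 <= ag w by apply: normc_ge0.
apply: (@le_trans _ _ (pathE n (fun w => transf_max R V nv n a 0 g w `^ s))).
  apply: le_pathE => w; rewrite ge0_ler_powR ?nnegrE ?(ltW s0)//.
  - have nvN v : nv (- v) = nv v.
      by rewrite -scaleN1r nvZ normcN ComplexField.Normc.normc1 mul1r.
    have nv0 : nv 0 = 0 by rewrite -(scale0r 0) nvZ ComplexField.Normc.normc0 mul0r.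
    by have := nvD (transf R V n a 0 g w) (- transf R V n a 0 g w);
      rewrite subrr nv0 nvN; lra.
  - exact: transf_max_ge0.
  - exact: nv_transf_le_max.
have eps0 : 0 < eta / H by rewrite divr_gt0.
have nv0 : nv 0 = 0 by rewrite -(scale0r 0) nvZ ComplexField.Normc.normc0 mul0r.
apply: (@le_trans _ _ (K1 * (eta / H)^-1 `^ s *
   pathE n (fun w => doob_max R n ag w `^ s))).
  apply: (@good_lambda_moment R n s (eta / H) (2 * (6 * eta) `^ q)) => //.
  - by rewrite mulr_ge0// powR_ge0.
  - by move=> w; apply: transf_max_ge0.
  - by move=> w; apply: doob_max_ge0.
  - exact: transf_max_bounded.
  move=> l l0.
  have -> : 6 * eta = 6 * H * (eta / H * l) / l by field; rewrite !gt_eqF.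
  apply: good_lambda => //; first exact: ltW.
  - by rewrite mulr_ge0 ?(ltW eps0) ?(ltW l0).
  - by rewrite mulrA (mulrCA H) divff ?gt_eqF// mulr1 -[leRHS]mul1r ler_wpM2r// ltW.
  - by rewrite nv0 ltW.
rewrite invf_div powRM ?invr_ge0 ?(ltW H0) ?(ltW eta0)//.
have := doob_inequality R s n ag s1 ag0; rewrite -/Kd => doob.
have -> : K1 * eta^-1 `^ s * Kd * H `^ s * pathE n (fun w => ag w `^ s) =
  K1 * (H `^ s * eta^-1 `^ s) * (Kd * pathE n (fun w => ag w `^ s)) by ring.
by rewrite ler_wpM2l//; apply: mulr_ge0; rewrite ?(ltW K10)// mulr_ge0 ?powR_ge0.
Qed.

(** * Dyadic intervals as binary paths *)

Section DyadicPaths.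
Variable R : realType.
Local Notation normc := (@ComplexField.Normc.normc R).
Local Notation mu := (@lebesgue_measure R).
Local Open Scope classical_set_scope.
Implicit Types (n k i : nat) (x : R) (f : R -> R[i]).

Definition dyI k i : set R := `[i%:R / 2 ^+ k, (i%:R + 1) / 2 ^+ k[.

(* [true] stands for the left half of a dyadic interval. *)
Definition child i (b : bool) : nat := (i.*2 + ~~ b)%N.

Definition left_half k i x : bool := x < i.*2.+1%:R / 2 ^+ k.+1.

Fixpoint digits n k i x : seq bool :=
  if n is m.+1 then
    let b := left_half k i x in b :: digits m k.+1 (child i b) x
  else [::].

Lemma pow2_gt0 k : 0 < 2 ^+ k :> R. Proof. by rewrite exprn_gt0. Qed.

Lemma measurable_dyI k i : measurable (dyI k i).
Proof. exact: measurable_itv. Qed.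

Lemma dyIP k i x : dyI k i x <-> (i%:R <= x * 2 ^+ k < i%:R + 1).
Proof.
rewrite /dyI /= in_itv/= ler_pdivrMr ?pow2_gt0// ltr_pdivlMr ?pow2_gt0//.
Qed.

Lemma dyI00 : dyI 0 0 = @Omega R.
Proof. by rewrite /dyI expr0 !divr1 add0r. Qed.

Lemma dyI_atom k i x : dyI k i x -> dyadic_atom k x = dyI k i.
Proof.
move=> /dyIP xi; rewrite /dyadic_atom (@floor_def _ _ (Posz i)) //.
by rewrite intrD.
Qed.

Lemma dyI_child k i b x : dyI k.+1 (child i b) x <-> dyI k i x /\ left_half k i x = b.
Proof.
have i2 : i.*2%:R = 2 * i%:R :> R by rewrite -muln2 natrM mulrC.
rewrite !dyIP /left_half ltr_pdivlMr ?pow2_gt0// exprS /child natrD -natr1 i2.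
set y := x * 2 ^+ k; have -> : x * (2 * 2 ^+ k) = 2 * y by rewrite mulrCA.
case: b => /=; rewrite ?addn0 ?addr0; split.
- by move=> /andP[? ?]; split; [apply/andP; split|]; lra.
- by move=> [/andP[? ?] ?]; apply/andP; split; lra.
- by move=> /andP[? ?]; split; [apply/andP; split|]; lra.
- by move=> [/andP[? ?] /negbT]; rewrite -leNgt => ?; apply/andP; split; lra.
Qed.

Lemma dyI_split k i : dyI k i = dyI k.+1 (child i true) `|` dyI k.+1 (child i false).
Proof.
apply/seteqP; split=> x.
  by move=> xi; case E: (left_half k i x); [left|right]; apply/dyI_child.
by case=> /dyI_child[].
Qed.

Lemma dyI_disj k i :
  [disjoint dyI k.+1 (child i true) & dyI k.+1 (child i false)].
Proof.
by apply/disj_setPS => x [] /dyI_child[_ xl] /dyI_child[_]; rewrite xl.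
Qed.

Lemma measure_dyI k i : mu (dyI k i) = ((2 ^+ k)^-1)%:E.
Proof.
rewrite /dyI lebesgue_measure_itv/= lte_fin ltr_pM2r ?invr_gt0 ?pow2_gt0//.
by rewrite ltrDl ltr01 -EFinB -mulrBl addrAC subrr add0r mul1r.
Qed.

Lemma measurable_digits n k i (phi : seq bool -> R) :
  measurable_fun (dyI k i) (fun x => phi (digits n k i x)).
Proof.
elim: n k i phi => [|n IH] k i phi; first by rewrite /=; exact: measurable_cst.
rewrite dyI_split; apply/measurable_funU; try exact: measurable_dyI.
split.
  apply: eq_measurable_fun (IH _ _ (phi \o cons true)) => x.
  by rewrite inE => /dyI_child[_ /= ->].
apply: eq_measurable_fun (IH _ _ (phi \o cons false)) => x.
by rewrite inE => /dyI_child[_ /= ->].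
Qed.

Lemma integral_digits n k i (phi : seq bool -> R) :
  (\int[mu]_(x in dyI k i) (phi (digits n k i x))%:E = ((2 ^+ k)^-1 * pathE n phi)%:E)%E.
Proof.
elim: n k i phi => [|n IH] k i phi.
  apply: etrans (integral_cst mu (measurable_dyI k i) (phi [::])%:E) _.
  rewrite [X in (_ * X)%E](_ : _ = ((2 ^+ k)^-1)%:E); last exact: measure_dyI.
  by rewrite -EFinM mulrC.
have mphi : measurable_fun (dyI k i) (fun x => (phi (digits n.+1 k i x))%:E).
  by apply/measurable_EFinP; apply: measurable_digits.
rewrite dyI_split integral_setU; last first.
- exact: dyI_disj.
- by rewrite -dyI_split.
- exact: measurable_dyI.
- exact: measurable_dyI.
have child_int b : (\int[mu]_(x in dyI k.+1 (child i b)) (phi (digits n.+1 k i x))%:E =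
    ((2 ^+ k.+1)^-1 * pathE n (phi \o cons b))%:E)%E.
  rewrite -(IH _ (child i b)); apply: eq_integral => x; rewrite inE => /dyI_child[_ /= ->].
  by [].
rewrite !child_int -EFinD; congr EFin; rewrite /= exprS.
by field; rewrite gt_eqF// pow2_gt0.
Qed.

Lemma integrable_digits n k i (phi : seq bool -> R) :
  mu.-integrable (dyI k i) (EFin \o (fun x => phi (digits n k i x))).
Proof.
apply/integrableP; split.
  by apply/measurable_EFinP; apply: measurable_digits.
rewrite [X in (X < _)%E](_ : _ = ((2 ^+ k)^-1 * pathE n (fun w => `|phi w|))%:E) ?ltry//.
by rewrite -(integral_digits n k i (fun w => `|phi w|)).
Qed.

Definition avg k i f : R[i] := ((2 ^+ k)%:C)%C * cintegral (dyI k i) f.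

Lemma condE_avg k i f x : dyI k i x -> condE k f x = avg k i f.
Proof. by move=> xi; rewrite /condE (dyI_atom _ _ _ xi). Qed.

Definition cintegrable (D : set R) f :=
  mu.-integrable D (EFin \o (fun x => complex.Re (f x))) /\
  mu.-integrable D (EFin \o (fun x => complex.Im (f x))).

Lemma cintegrable_child k i b f :
  cintegrable (dyI k i) f -> cintegrable (dyI k.+1 (child i b)) f.
Proof.
have sub : dyI k.+1 (child i b) `<=` dyI k i by move=> x /dyI_child[].
by case=> fr fi; split; [move: fr|move: fi]; apply: integrableS => //;
  apply: measurable_dyI.
Qed.

Lemma avg_split k i f : cintegrable (dyI k i) f ->
  avg k i f = (avg k.+1 (child i true) f + avg k.+1 (child i false) f) / 2.
Proof.
move=> [fr fi]; rewrite /avg /cintegral dyI_split.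
rewrite !Rintegral_setU -?dyI_split//; try exact: measurable_dyI; try exact: dyI_disj.
have cD (a b c d : R) : ((a + b) +i* (c + d) = (a +i* c) + (b +i* d))%C by [].
rewrite cD exprS rmorphM/= [2%:C%C](_ : _ = 2); last first.
  by rewrite -[2 in LHS]/(1 *+ 2) rmorphMn rmorph1.
by field.
Qed.


Lemma pathE_complex n (phi : seq bool -> R[i]) :
  pathE n phi = (pathE n (fun w => complex.Re (phi w)) +i*
                 pathE n (fun w => complex.Im (phi w)))%C.
Proof.
elim: n phi => [|n IH] phi; first by rewrite /=; case: (phi [::]).
rewrite /= !IH; apply: (@mulIf _ 2); first by rewrite pnatr_eq0.
rewrite divfK ?pnatr_eq0// mulr_natr mulr2n; apply/eqP; rewrite eq_complex /comp /=.
by apply/andP; split; apply/eqP; field.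
Qed.

(* [phi] lists, in binary order, the averages of [f] over the [2 ^ n]
   subintervals of generation [k + n] of [dyI k i]. *)
Fixpoint leaf_averages n k i f (phi : seq bool -> R[i]) : Prop :=
  avg k i f = pathE n phi /\
  if n is m.+1 then
    forall b, leaf_averages m k.+1 (child i b) f (phi \o cons b)
  else True.

Lemma transf_leaf_averages (V : lmodType R[i]) n k i f phi (a : nat -> V) v x :
  leaf_averages n k i f phi -> dyI k i x ->
  transf R V n a v phi (digits n k i x) =
  v + \sum_(l < n) mdiff (k + l).+1 f x *: a l.
Proof.
elim: n k i phi a v => [|n IH] k i phi a v; first by rewrite big_ord0 addr0.
move=> [fk fchild] xi; set b := left_half k i x.
have xb : dyI k.+1 (child i b) x by apply/dyI_child.
have fb : avg k.+1 (child i b) f = pathE n (phi \o cons b).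
  by have := fchild b; case: (n) => [|m] [].
rewrite transfS (IH k.+1 (child i b))//; last exact: fchild.
rewrite /step -fb -fk -(condE_avg _ _ f _ xb) -(condE_avg _ _ f _ xi).
rewrite big_ord_recl addn0 -addrA; congr (_ + (_ + _)).
by apply: eq_bigr => l _; rewrite lift0 addSnnS.
Qed.

Fixpoint leaf_avg n k i f (w : seq bool) : R[i] :=
  if n is m.+1 then leaf_avg m k.+1 (child i (head true w)) f (behead w)
  else avg k i f.

Lemma leaf_averages_avg n k i f : cintegrable (dyI k i) f ->
  leaf_averages n k i f (leaf_avg n k i f).
Proof.
elim: n k i => [|n IH] k i fi; first by split.
have fb b := IH _ _ (cintegrable_child _ _ b _ fi).
have ab b : avg k.+1 (child i b) f = pathE n (leaf_avg n k.+1 (child i b) f).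
  by have := fb b; case: (n) => [|m] [].
by split; [rewrite (avg_split _ _ _ fi) !ab|exact: fb].
Qed.

Lemma cintegral_digits n k i (phi : seq bool -> R[i]) f :
  (forall x, dyI k i x -> f x = phi (digits n k i x)) ->
  avg k i f = pathE n phi.
Proof.
move=> fphi; rewrite /avg /cintegral.
have int (c : R[i] -> R) : Rintegral mu (dyI k i) (fun x => c (f x)) =
    (2 ^+ k)^-1 * pathE n (c \o phi).
  transitivity (Rintegral mu (dyI k i) (fun x => (c \o phi) (digits n k i x))).
    by apply: eq_Rintegral => x; rewrite inE => /fphi /= ->.
  by rewrite /Rintegral (integral_digits n k i (c \o phi)).
rewrite (int (@complex.Re R)) (int (@complex.Im R)) [in RHS]pathE_complex.
rewrite -[((2 ^+ k)%:C)%C]/(((2 ^+ k) +i* 0)%C).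
apply/eqP; rewrite eq_complex /=; apply/andP; split; apply/eqP;
  by rewrite mul0r ?subr0 ?addr0 mulVKf// gt_eqF// pow2_gt0.
Qed.

Lemma leaf_averages_digits n k i (phi : seq bool -> R[i]) f :
  (forall x, dyI k i x -> f x = phi (digits n k i x)) ->
  leaf_averages n k i f phi.
Proof.
elim: n k i phi => [|n IH] k i phi fphi.
  by split=> //; apply: cintegral_digits.
split; first exact: cintegral_digits.
by move=> b; apply: IH => x /dyI_child[xi xb]; rewrite fphi//= xb.
Qed.

Definition mxnorm M (v : 'cV[R[i]]_M) : R := \big[Num.max/0]_(j < M) normc (v j 0).

Lemma mxnorm_ge0 M (v : 'cV[R[i]]_M) : 0 <= mxnorm M v.
Proof. by apply: bigmax_ge_id. Qed.

Lemma mxnormD M (u v : 'cV[R[i]]_M) : mxnorm M (u + v) <= mxnorm M u + mxnorm M v.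
Proof.
apply: bigmax_le => [|j _]; first by rewrite addr_ge0 ?mxnorm_ge0.
rewrite mxE (le_trans (le_normcD _ _))// lerD//.
  exact: (le_bigmax _ (fun j => normc (u j 0))).
exact: (le_bigmax _ (fun j => normc (v j 0))).
Qed.

Lemma mxnormZ M (c : R[i]) (v : 'cV[R[i]]_M) : mxnorm M (c *: v) = normc c * mxnorm M v.
Proof.
rewrite /mxnorm; under eq_bigr do rewrite mxE ComplexField.Normc.normcM.
elim/big_rec2: _ => [|j y1 y2 _ ->]; first by rewrite mulr0.
by rewrite maxr_pMr// normc_ge0.
Qed.

Definition cols M N (A : 'M[R[i]]_(M, N)) (l : nat) : 'cV[R[i]]_M :=
  if insub l is Some k then col k A else 0.

Lemma maxop_transf M N (A : 'M[R[i]]_(M, N)) f phi x :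
  leaf_averages N 0 0 f phi -> Omega x ->
  maxop A f x = mxnorm M (transf R _ N (cols M N A) 0 phi (digits N 0 0 x)).
Proof.
rewrite -dyI00 => fphi x0; rewrite (transf_leaf_averages _ _ _ _ _ _ _ _ _ fphi x0) add0r.
apply: eq_bigr => j _; congr normc; rewrite summxE; apply: eq_bigr => l _.
by rewrite add0n mxE /cols valK mxE mulrC.
Qed.

Import HBNNSimple.

(* [F] is not assumed measurable: [inLp] says nothing outside [Omega]. *)
Lemma integral_Prob (F : R -> \bar R) : (forall x, 0 <= F x)%E ->
  (\int[@Prob R]_x F x = \int[mu]_(x in @Omega R) F x)%E.
Proof.
move=> F0; have mO : measurable (@Omega R) by exact: measurable_Omega.
transitivity (\int[@Prob R]_(x in @Omega R) F x)%E; last first.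
  by apply: eq_measure_integral => A mA AO; exact: (congr1 mu (setIidl AO)).
apply/eqP; rewrite eq_le; apply/andP; split; last first.
  rewrite ge0_integralTE// ge0_integralE//; apply: le_ereal_sup => _ /= [g gF <-].
  exists g => // x; apply: le_trans (gF x) _; rewrite patchE; case: ifP => //.
rewrite [leLHS]ge0_integralTE//; apply: ge_ereal_sup => _ /= [g gF <-].
have -> : sintegral (@Prob R) g = (\int[@Prob R]_(x in @Omega R) (g x)%:E)%E.
  transitivity (\int[@Prob R]_x (g x)%:E)%E.
    by rewrite integral_nnsfun// patch_setT.
  rewrite (@ge0_negligible_integral _ _ _ (@Prob R) setT (~` @Omega R))//.
  - by rewrite setTD setCK.
  - exact: measurableC.
  - by apply/measurable_EFinP; apply: measurable_funP.
  - by move=> x _; rewrite lee_fin.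
  - by rewrite -(measure0 mu); exact: (congr1 mu (setICl _)).
rewrite !ge0_integralE//; last by move=> x _; rewrite lee_fin.
apply: le_ereal_sup => _ /= [g' g'g <-]; exists g' => // x.
by apply: le_trans (g'g x) _; rewrite !patchE; case: ifP.
Qed.

Lemma LpnormE (q : R) (g : R -> R) : 
  (Lpnorm q g = (\int[mu]_(x in @Omega R) (`|g x| `^ q)%:E) `^ q^-1)%E.
Proof.
rewrite /Lpnorm unlock /= integral_Prob => [|x]; last by rewrite lee_fin powR_ge0.
by [].
Qed.

Lemma Lpnorm_digits N (q : R) (X : seq bool -> R) (g : R -> R) :
  (forall w, 0 <= X w) -> (forall x, Omega x -> g x = X (digits N 0 0 x)) ->
  Lpnorm q g = (pathE N (fun w => X w `^ q) `^ q^-1)%:E.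
Proof.
move=> X0 gX; rewrite LpnormE -poweR_EFin; congr (_ `^ _)%E.
transitivity (\int[mu]_(x in dyI 0 0) (X (digits N 0 0 x) `^ q)%:E)%E.
  rewrite dyI00; apply: eq_integral => x; rewrite inE => /gX ->.
  by rewrite ger0_norm.
by rewrite (integral_digits N 0 0 (fun w => X w `^ q)) expr0 invr1 mul1r.
Qed.

Lemma normc_le_ReIm (z : R[i]) : normc z <= `|complex.Re z| + `|complex.Im z|.
Proof.
case: z => a b /=; rewrite -[leRHS]ger0_norm ?addr_ge0// -sqrtr_sqr ler_wsqrtr//.
rewrite sqrrD !real_normK ?num_real//.
by rewrite addrAC lerDl mulrn_wge0// mulr_ge0.
Qed.

Lemma Re_le_normc (z : R[i]) : `|complex.Re z| <= normc z.
Proof. by case: z => a b /=; rewrite -sqrtr_sqr ler_wsqrtr// lerDl sqr_ge0. Qed.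

Lemma Im_le_normc (z : R[i]) : `|complex.Im z| <= normc z.
Proof. by case: z => a b /=; rewrite -sqrtr_sqr ler_wsqrtr// lerDr sqr_ge0. Qed.

Lemma measurable_normc (D : set R) f : measurable D ->
  measurable_fun D (fun x => complex.Re (f x)) ->
  measurable_fun D (fun x => complex.Im (f x)) ->
  measurable_fun D (fun x => normc (f x)).
Proof.
move=> mD fr fi.
have -> : (fun x => normc (f x)) =
    (fun x => (complex.Re (f x) ^+ 2 + complex.Im (f x) ^+ 2) `^ 2^-1).
  apply/funext => x; rewrite powR12_sqrt ?addr_ge0 ?sqr_ge0//.
  by case: (f x).
apply: (measurableT_comp (measurable_powR _)).
by apply: measurable_funD; apply: measurable_funX.
Qed.

Lemma inLp_integrable (p : R) f : 0 < p -> inLp p f ->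
  mu.-integrable (@Omega R) (EFin \o (fun x => normc (f x) `^ p)).
Proof.
move=> p0 [fr fi fp]; apply/integrableP; split.
  apply/measurable_EFinP; apply: (measurableT_comp (measurable_powR _)).
  exact: measurable_normc (@measurable_Omega R) fr fi.
move: fp; rewrite LpnormE => /(poweR_lty p).
rewrite -poweRrM mulVf ?gt_eqF// poweRe1; last first.
  by apply: integral_ge0 => x _; rewrite lee_fin powR_ge0.
congr (_ < _)%E; apply: eq_integral => x _ /=.
by rewrite (ger0_norm (normc_ge0 _ _)) ger0_norm ?powR_ge0.
Qed.

Definition cLp_on (p : R) k i f :=
  [/\ cintegrable (dyI k i) f,
      mu.-integrable (dyI k i) (EFin \o (fun x => normc (f x))) &
      mu.-integrable (dyI k i) (EFin \o (fun x => normc (f x) `^ p))].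

Lemma cLp_on_child p k i b f : cLp_on p k i f -> cLp_on p k.+1 (child i b) f.
Proof.
have sub : dyI k.+1 (child i b) `<=` dyI k i by move=> x /dyI_child[].
case=> fc f1 fp; split; first exact: cintegrable_child.
  by apply: integrableS f1 => //; apply: measurable_dyI.
by apply: integrableS fp => //; apply: measurable_dyI.
Qed.

Lemma inLp_cLp_on p f : 1 < p -> inLp p f -> cLp_on p 0 0 f.
Proof.
move=> p1 fLp; have p0 : 0 < p by lra.
have fp := inLp_integrable _ _ p0 fLp; case: fLp => fr fi _.
have mO : @measurable _ (measurableTypeR R) (@Omega R) by rewrite -dyI00; exact: measurable_dyI.
have f1 : mu.-integrable (@Omega R) (EFin \o (fun x => normc (f x))).
  have gi : mu.-integrable (@Omega R) (EFin \o (fun x => 1 + normc (f x) `^ p)).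
    have c1 : mu.-integrable (@Omega R) (EFin \o (fun=> 1)).
      by rewrite -dyI00; exact: (integrable_digits 0 0 0 (fun=> 1)).
    by apply: eq_integrable (integrableD mO c1 fp).
  apply: le_integrable gi => //.
  - by apply/measurable_EFinP; exact: measurable_normc.
  - move=> x _ /=; rewrite lee_fin !ger0_norm ?addr_ge0 ?powR_ge0 ?normc_ge0//.
    have := powR_tangent _ _ _ 1 (ltW p1) (normc_ge0 _ (f x)) ler01.
    rewrite !powR1 !mulr1 => tgt; have := powR_ge0 (normc (f x)) p.
    have := normc_ge0 _ (f x); nra.
rewrite /cLp_on dyI00; split=> //; split.
  apply: le_integrable f1 => //; first exact/measurable_EFinP.
  by move=> x _ /=; rewrite lee_fin (ger0_norm (normc_ge0 _ _)) Re_le_normc.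
apply: le_integrable f1 => //; first exact/measurable_EFinP.
by move=> x _ /=; rewrite lee_fin (ger0_norm (normc_ge0 _ _)) Im_le_normc.
Qed.

Lemma powR_dyadic_mean (p : R) k i (u : R -> R) : 1 <= p -> (forall x, 0 <= u x) ->
  mu.-integrable (dyI k i) (EFin \o u) ->
  mu.-integrable (dyI k i) (EFin \o (fun x => u x `^ p)) ->
  (2 ^+ k * Rintegral mu (dyI k i) u) `^ p <=
  2 ^+ k * Rintegral mu (dyI k i) (fun x => u x `^ p).
Proof.
move=> p1 u0 ui upi; set m := 2 ^+ k * _.
have mI : @measurable _ (measurableTypeR R) (dyI k i) := measurable_dyI k i.
have k0 := pow2_gt0 k.
have m0 : 0 <= m by rewrite mulr_ge0 ?(ltW k0)// Rintegral_ge0.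
have ci (c : R) : mu.-integrable (dyI k i) (EFin \o (fun=> c)).
  exact: (integrable_digits 0 k i (fun=> c)).
have : Rintegral mu (dyI k i) (fun x => p * m `^ (p - 1) * u x) <=
       Rintegral mu (dyI k i) (fun x => u x `^ p + (p - 1) * m `^ p).
  apply: le_Rintegral => //.
  - exact: (integrableZl mI (p * m `^ (p - 1)) ui).
  - exact: (integrableD mI upi (ci _)).
  - by move=> x _; apply: powR_tangent.
rewrite RintegralZl// RintegralD//.
have -> : Rintegral mu (dyI k i) (fun=> (p - 1) * m `^ p) =
    (2 ^+ k)^-1 * ((p - 1) * m `^ p).
  by rewrite /Rintegral (integral_digits 0 k i (fun=> (p - 1) * m `^ p)).
rewrite -(ler_pM2l k0) mulrDr mulVKf ?gt_eqF// mulrCA -/m.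
rewrite (_ : p * m `^ (p - 1) * m = p * m `^ p); last first.
  by rewrite -mulrA [_ * m]mulrC mulr_powRB1//; lra.
lra.
Qed.

Lemma normc_avg k i f : cintegrable (dyI k i) f ->
  mu.-integrable (dyI k i) (EFin \o (fun x => normc (f x))) ->
  normc (avg k i f) <= 2 * (2 ^+ k * Rintegral mu (dyI k i) (fun x => normc (f x))).
Proof.
move=> [fr fi] f1; have mI : @measurable _ (measurableTypeR R) (dyI k i) := measurable_dyI k i.
have k0 := ltW (pow2_gt0 k).
rewrite /avg ComplexField.Normc.normcM.
have -> : normc ((2 ^+ k)%:C)%C = 2 ^+ k.
  by rewrite /= expr0n/= addr0 sqrtr_sqr ger0_norm.
rewrite mulrCA ler_wpM2l// (le_trans (normc_le_ReIm _))// /cintegral /=.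
have part (c : R[i] -> R) : (forall z, `|c z| <= normc z) ->
    mu.-integrable (dyI k i) (EFin \o (fun x => c (f x))) ->
    `|Rintegral mu (dyI k i) (fun x => c (f x))| <=
    Rintegral mu (dyI k i) (fun x => normc (f x)).
  move=> cn ci; apply: le_trans (le_normr_Rintegral mI ci) _.
  by apply: le_Rintegral => //; exact: integrable_norm ci.
by rewrite mulr_natl mulr2n; apply: lerD;
  [exact: (part _ Re_le_normc fr)|exact: (part _ Im_le_normc fi)].
Qed.

Lemma pathE_leaf_avg p n k i f : 1 < p -> cLp_on p k i f ->
  pathE n (fun w => normc (leaf_avg n k i f w) `^ p) <=
  2 `^ p * (2 ^+ k * Rintegral mu (dyI k i) (fun x => normc (f x) `^ p)).
Proof.
move=> p1; elim: n k i => [|n IH] k i fp.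
  case: fp => fc f1 fp /=.
  have nf0 x : 0 <= normc (f x) by apply: normc_ge0.
  have k0 := ltW (pow2_gt0 k).
  apply: le_trans (_ : _ <= (2 * (2 ^+ k * Rintegral mu (dyI k i) (fun x => normc (f x)))) `^ p) _.
    apply: ge0_ler_powR; rewrite ?nnegrE ?normc_ge0 ?mulr_ge0 ?Rintegral_ge0//; first lra.
    exact: normc_avg.
  rewrite powRM ?mulr_ge0 ?Rintegral_ge0// ler_wpM2l ?powR_ge0//.
  by apply: powR_dyadic_mean => //; lra.
have := IH _ _ (cLp_on_child _ _ _ true _ fp).
have := IH _ _ (cLp_on_child _ _ _ false _ fp).
have -> : Rintegral mu (dyI k i) (fun x => normc (f x) `^ p) =
    Rintegral mu (dyI k.+1 (child i true)) (fun x => normc (f x) `^ p) +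
    Rintegral mu (dyI k.+1 (child i false)) (fun x => normc (f x) `^ p).
  rewrite dyI_split; apply: Rintegral_setU; rewrite -?dyI_split.
  - exact: measurable_dyI.
  - exact: measurable_dyI.
  - by case: fp.
  - exact: dyI_disj.
rewrite [X in _ -> _ -> X <= _]/= /comp /= exprS.
set a := pathE _ _; set b := pathE _ _; set c := Rintegral _ _ _; set d := Rintegral _ _ _.
move=> h1 h2.
apply: le_trans (_ : _ <= (2 `^ p * (2 * 2 ^+ k * d) + 2 `^ p * (2 * 2 ^+ k * c)) / 2) _.
  by rewrite ler_pM2r ?invr_gt0// lerD.
by rewrite le_eqVlt; apply/predU1P; left; field.
Qed.

Lemma admissible_transf_bounded (p q : R) M N (A : 'M[R[i]]_(M, N)) C :
  0 < p -> 0 < q -> admissible p q A C ->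
  transf_bounded R _ (mxnorm M) q C N (cols M N A).
Proof.
move=> p0 q0 [C0 adm] g B B0 gB.
pose f x := g (digits N 0 0 x).
have fphi : leaf_averages N 0 0 f g by apply: leaf_averages_digits.
have normf : Lpnorm p (fun x => normc (f x)) = (pathE N (fun w => normc (g w) `^ p) `^ p^-1)%:E.
  by apply: (Lpnorm_digits N p (normc \o g)) => // w; apply: normc_ge0.
have fLp : inLp p f.
  split; rewrite ?normf ?ltry// -dyI00.
    exact: (measurable_digits N 0 0 (fun w => complex.Re (g w))).
  exact: (measurable_digits N 0 0 (fun w => complex.Im (g w))).
have := adm _ fLp.
rewrite (Lpnorm_digits N q (fun w => mxnorm M (transf R _ N (cols M N A) 0 g w))); last 2 first.
- by move=> w; apply: mxnorm_ge0.
- by move=> x x0; apply: maxop_transf.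
rewrite normf -EFinM lee_fin => le1.
set E := pathE _ _ in le1 *.
have E0 : 0 <= E by apply: pathE_ge0 => w; apply: powR_ge0.
have -> : E = (E `^ q^-1) `^ q by rewrite -powRrM mulVf ?gt_eqF// powRr1.
apply: ge0_ler_powR; rewrite ?nnegrE ?powR_ge0 ?mulr_ge0 ?(ltW q0)//.
apply: le_trans le1 _; rewrite ler_wpM2l//.
have -> : B = (B `^ p) `^ p^-1 by rewrite -powRrM divff ?gt_eqF// powRr1.
apply: ge0_ler_powR; rewrite ?nnegrE ?powR_ge0 ?invr_ge0 ?(ltW p0)//.
  by apply: pathE_ge0 => w; apply: powR_ge0.
rewrite -[leRHS](pathE_cst R N); apply: le_pathE => w.
by apply: ge0_ler_powR; rewrite ?nnegrE ?normc_ge0 ?(ltW p0).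
Qed.

Lemma admissible_transfer (p0 q0 p1 q1 : R) :
  0 < p0 -> 0 < q0 -> 1 < p1 -> 0 < q1 -> q1 <= p1 ->
  exists K : R, 0 < K /\ forall M N (A : 'M[R[i]]_(M, N)) C C',
    admissible p0 q0 A C -> C < C' -> admissible p1 q1 A (K * C').
Proof.
move=> p00 q00 p11 q10 qp.
have p10 : 0 < p1 by lra.
have [K0 [K00 strong]] := transf_strong R q0 p1 q00 p11.
exists (K0 `^ p1^-1 * 2); split; first by rewrite mulr_gt0// powR_gt0.
move=> M N A C C' adm CC'.
have C0 : 0 <= C by case: adm.
have C'0 : 0 < C' by lra.
have bnd : transf_bounded R _ (mxnorm M) q0 C' N (cols M N A).
  move=> g B B0 gB; apply: le_trans (admissible_transf_bounded _ _ _ _ _ _ p00 q00 adm g B B0 gB) _.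
  apply: ge0_ler_powR; rewrite ?nnegrE ?mulr_ge0 ?(ltW q00) ?(ltW C'0)//.
  by rewrite ler_wpM2r// ltW.
split; first by rewrite !mulr_ge0 ?powR_ge0 ?(ltW C'0).
move=> f fLp; have fon := inLp_cLp_on _ _ p11 fLp.
pose phi := leaf_avg N 0 0 f.
have fphi : leaf_averages N 0 0 f phi by apply: leaf_averages_avg; case: fon.
pose X w := mxnorm M (transf R _ N (cols M N A) 0 phi w).
have X0 w : 0 <= X w by apply: mxnorm_ge0.
rewrite (Lpnorm_digits N q1 X)//; last by move=> x x0; apply: maxop_transf.
set I := Rintegral mu (@Omega R) (fun x => normc (f x) `^ p1).
have I0 : 0 <= I by apply: Rintegral_ge0 => x _; apply: powR_ge0.
have -> : Lpnorm p1 (fun x => normc (f x)) = (I `^ p1^-1)%:E.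
  rewrite LpnormE -poweR_EFin; congr (_ `^ _)%E; rewrite /I /Rintegral fineK.
    by apply: eq_integral => x _; rewrite (ger0_norm (normc_ge0 _ _)).
  apply: integrable_fin_num (inLp_integrable _ _ p10 fLp).
  exact: measurable_Omega.
rewrite -EFinM lee_fin.
have XI : pathE N (fun w => X w `^ p1) <= K0 * C' `^ p1 * (2 `^ p1 * I).
  apply: le_trans (strong _ _ (mxnormD M) (mxnormZ M) _ _ _ C'0 bnd phi) _.
  rewrite ler_wpM2l ?mulr_ge0 ?powR_ge0 ?(ltW K00)//.
  by have := pathE_leaf_avg _ N _ _ _ p11 fon; rewrite expr0 mul1r dyI00.
have EX0 r : 0 <= pathE N (fun w => X w `^ r).
  by apply: pathE_ge0 => w; apply: powR_ge0.
have jensen : pathE N (fun w => X w `^ q1) `^ (p1 / q1) <= pathE N (fun w => X w `^ p1).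
  apply: le_trans (powR_pathE _ _ _ _ _ _) _.
  - by rewrite ler_pdivlMr// mul1r.
  - by move=> w; apply: powR_ge0.
  - by apply: le_pathE => w; rewrite -powRrM mulrCA divff ?gt_eqF// mulr1.
have -> : pathE N (fun w => X w `^ q1) `^ q1^-1 =
    (pathE N (fun w => X w `^ q1) `^ (p1 / q1)) `^ p1^-1.
  by rewrite -powRrM mulrAC divff ?gt_eqF// mul1r.
have -> : K0 `^ p1^-1 * 2 * C' * I `^ p1^-1 = (K0 * C' `^ p1 * (2 `^ p1 * I)) `^ p1^-1.
  rewrite !powRM ?mulr_ge0 ?powR_ge0 ?(ltW K00)//.
  by rewrite -!powRrM divff ?gt_eqF// !powRr1 ?(ltW C'0)//; ring.
apply: ge0_ler_powR; rewrite ?nnegrE ?powR_ge0 ?invr_ge0 ?(ltW p10)//.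
  by rewrite !mulr_ge0 ?powR_ge0 ?(ltW K00).
exact: le_trans XI.
Qed.

Lemma hpq_ge0 (p q : R) M N (A : 'M[R[i]]_(M, N)) : (0 <= hpq p q A)%E.
Proof. by apply/ereal_infP => _ [C [C0 _] <-]; rewrite lee_fin. Qed.

Lemma hpq_transfer (p0 q0 p1 q1 : R) :
  0 < p0 -> 0 < q0 -> 1 < p1 -> 0 < q1 -> q1 <= p1 ->
  exists K : R, 0 < K /\ forall M N (A : 'M[R[i]]_(M, N)),
    (hpq p1 q1 A <= K%:E * hpq p0 q0 A)%E.
Proof.
move=> p00 q00 p11 q10 qp.
have [K [K0 tr]] := admissible_transfer _ _ _ _ p00 q00 p11 q10 qp.
exists K; split=> // M N A; rewrite -lee_pdivrMl//.
apply/ereal_infP => _ [C adm <-]; apply/lee_addgt0Pr => e e0.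
rewrite lee_pdivrMl// -EFinD -EFinM; apply: ereal_inf_lbound.
by exists (K * (C + e)) => //; apply: tr adm _; rewrite ltrDl.
Qed.

End DyadicPaths.

Theorem theorem2p2 (R : realType) (p q : R) :
  1 < p -> 0 < q -> q < p ->
  exists C : R, 0 < C /\
    forall (M N : nat) (A : 'M[R[i]]_(M, N)),
      ((C^-1)%:E * h A <= hpq p q A /\ hpq p q A <= C%:E * h A)%E.
Proof.
move=> p1 q0 qp; have p0 : 0 < p by lra.
have two0 : 0 < 2 :> R by lra.
have two1 : 1 < 2 :> R by lra.
have [K1 [K10 le1]] := hpq_transfer R 2 2 p q two0 two0 p1 q0 (ltW qp).
have [K2 [K20 le2]] := hpq_transfer R p q 2 2 p0 q0 two1 two0 (lexx _).
exists (Num.max K1 K2); have C0 : 0 < Num.max K1 K2 by rewrite lt_max K10.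
split=> // M N A; split.
  rewrite lee_pdivrMl//; apply: le_trans (le2 M N A) _.
  by rewrite lee_wpmul2r ?hpq_ge0// lee_fin le_max lexx orbT.
apply: le_trans (le1 M N A) _.
by rewrite lee_wpmul2r ?hpq_ge0// lee_fin le_max lexx.
Qed.
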